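(* Let $\Gamma$ be an oriented graph possessing properties (CF) and (EE). Then every vertex of $\Gamma$ has a unique root.
   Context: Let $\Gamma$ be an oriented graph with vertex set $V(\Gamma)$; each edge has an initial vertex and a terminal vertex. For an edge with initial vertex $v$ and terminal vertex $w$, the transition from $v$ to $w$ is called an edge move on $v$. Root: a vertex $R(v)$ is a root of a vertex $v$ if (1) $R(v)$ can be obtained from $v$ by (a finite, possibly empty, sequence of) edge moves, and (2) $R(v)$ admits no further edge moves (no edge has initial vertex $R(v)$). A set is well ordered if every nonempty subset of it has a least element. Property (CF): there exist a well ordered set $A$ and a map $c\colon V(\Gamma)\to A$ (a complexity function) such that $c(v)>c(w)$ for every edge oriented from $v$ to $w$. Two edges with the same initial vertex are elementary equivalent if their terminal vertices have a common root. Two edges $e,d$ with the same initial vertex $v$ are equivalent if there is a finite sequence of edges $e=e_1,e_2,\ldots,e_n=d$, all with initial vertex $v$, such that $e_i$ and $e_{i+1}$ are elementary equivalent for all $1\le i<n$. Property (EE): any two edges of $\Gamma$ with common initial vertex are equivalent. *)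

(* Defs.v *)
(* Stdlib world. *)
From Stdlib Require Export Relations.

(* Loops and multiple edges are allowed; no finiteness is assumed. *)
Record oriented_graph : Type := OrientedGraph {
  vertex : Type;
  edge : Type;
  initial : edge -> vertex;
  terminal : edge -> vertex
}.

Arguments initial {_} _.
Arguments terminal {_} _.

Definition edge_move (G : oriented_graph) : relation (vertex G) :=
  fun v w => exists e : edge G, initial e = v /\ terminal e = w.

(* [is_root G v r]: r is a root of v. *)
Definition is_root (G : oriented_graph) (v r : vertex G) : Prop :=
  clos_refl_trans (vertex G) (edge_move G) v r /\
  ~ (exists e : edge G, initial e = r).

(* Totality of [le] is not listed: it is the case of two-element subsets. *)
Definition well_order (A : Type) (le : relation A) : Prop :=
  order A le /\
  forall S : A -> Prop, (exists x, S x) ->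
    exists m, S m /\ forall x, S x -> le m x.

Definition property_CF (G : oriented_graph) : Prop :=
  exists (A : Type) (le : relation A) (c : vertex G -> A),
    well_order A le /\
    forall e : edge G,
      le (c (terminal e)) (c (initial e)) /\ c (terminal e) <> c (initial e).

Definition elementary_equivalent (G : oriented_graph) : relation (edge G) :=
  fun e d =>
    initial e = initial d /\
    exists r : vertex G, is_root G (terminal e) r /\ is_root G (terminal d) r.

(* Consecutive edges of a chain of elementary equivalences share their initial
   vertex, so the whole chain stays at that of its first edge. *)
Definition equivalent_edges (G : oriented_graph) : relation (edge G) :=
  clos_refl_trans (edge G) (elementary_equivalent G).

Definition property_EE (G : oriented_graph) : Prop :=
  forall e d : edge G, initial e = initial d -> equivalent_edges G e d.

(* Main.v *)
Require Import Defs.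
From Stdlib Require Import Classical.

(** A complexity function makes Noetherian induction along edges available
    ([edge_induction]), so existence and uniqueness of the root of [v] may be
    proved together, assuming them for the terminal vertices of all edges
    starting at [v].

    If no edge starts at [v], then [v] is its own only root.  Otherwise the
    roots of [v] are exactly the roots of the terminal vertices of its edges
    ([is_root_step], [is_root_inv]), so a root exists, and the question is
    whether two edges at [v] can lead to different roots.  Elementary equivalent
    edges cannot: their terminal vertices share a root, which by induction is the
    only root of either.  Equality of roots then propagates along the chain
    joining any two edges at [v] ([equivalent_edges_root]). *)

(** A vertex violating [P] of least complexity would have only edges leading to
    vertices satisfying [P]. *)
Lemma edge_induction (G : oriented_graph) (P : vertex G -> Prop) :
  property_CF G ->
  (forall v, (forall e : edge G, initial e = v -> P (terminal e)) -> P v) ->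
  forall v, P v.
Proof.
intros [A [le [c [[[_ _ anti] least] decr]]]] step v.
apply NNPP; intros nPv.
destruct (least (fun a => exists w, c w = a /\ ~ P w)) as [m [[w [cw nPw]] min]].
{ now exists (c v), v. }
apply nPw, step; intros e ew.
apply NNPP; intros nPe.
destruct (decr e) as [le_e neq_e].
apply neq_e, anti; [exact le_e|].
rewrite ew, cw; apply min.
now exists (terminal e).
Qed.

Lemma is_root_refl (G : oriented_graph) (v : vertex G) :
  ~ (exists e : edge G, initial e = v) -> is_root G v v.
Proof. intros stuck; split; [apply rt_refl | exact stuck]. Qed.

Lemma is_root_step (G : oriented_graph) (e : edge G) (r : vertex G) :
  is_root G (terminal e) r -> is_root G (initial e) r.
Proof.
intros [path stuck]; split; [|exact stuck].
apply rt_trans with (terminal e); [apply rt_step; now exists e | exact path].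
Qed.

Lemma is_root_inv (G : oriented_graph) (v r : vertex G) :
  is_root G v r ->
  v = r \/ exists e : edge G, initial e = v /\ is_root G (terminal e) r.
Proof.
intros [path stuck].
apply clos_rt_rt1n in path.
destruct path as [|w r [e [ev ew]] path]; [now left|].
right; exists e; split; [exact ev|].
rewrite ew; split; [now apply clos_rt1n_rt | exact stuck].
Qed.

(** Uniqueness is needed at every edge of the chain: it identifies the common
    root of one elementary equivalence with the common root of the next. *)
Lemma equivalent_edges_root (G : oriented_graph) (e d : edge G) :
  (forall f : edge G, initial f = initial e ->
     exists! r, is_root G (terminal f) r) ->
  equivalent_edges G e d ->
  forall r, is_root G (terminal e) r -> is_root G (terminal d) r.
Proof.
intros uniq chain.
apply clos_rt_rt1n in chain.
induction chain as [e | e f d [ef [s [es fs]]] _ IH]; intros r er; [exact er|].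
apply IH.
- intros g gf; apply uniq; now rewrite gf.
- destruct (uniq e eq_refl) as [t [_ t_only]].
  now rewrite <- (t_only r er), (t_only s es).
Qed.

Theorem theorem1 (G : oriented_graph) (hCF : property_CF G)
  (hEE : property_EE G) (v : vertex G) :
  exists! r : vertex G, is_root G v r.
Proof.
revert v; apply (edge_induction G _ hCF); intros v IH.
destruct (classic (exists e : edge G, initial e = v)) as [[e ev] | stuck].
- destruct (IH e ev) as [r [er _]].
  exists r; split; [rewrite <- ev; now apply is_root_step|].
  intros s vs.
  destruct (is_root_inv G v s vs) as [-> | [d [dv ds]]].
  + destruct vs as [_ stuck]; destruct stuck; now exists e.
  + assert (dr : is_root G (terminal d) r).
    { apply (equivalent_edges_root G e d); [|apply hEE; congruence | exact er].
      intros f fe; apply IH; congruence. }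
    destruct (IH d dv) as [t [_ t_only]].
    now rewrite <- (t_only r dr), (t_only s ds).
- exists v; split; [now apply is_root_refl|].
  intros s vs.
  destruct (is_root_inv G v s vs) as [vs' | [e [ev _]]]; [exact vs'|].
  destruct stuck; now exists e.
Qed.
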